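(* Let $P$ be a natural unit interval order on $[n]$. Then the sequence $(a_{P,j}(q))_{0\le j\le |E(\mathrm{inc}(P))|}$ is palindromic, i.e., $a_{P,j}(q)=a_{P,\,|E(\mathrm{inc}(P))|-j}(q)$ for all $0\le j\le |E(\mathrm{inc}(P))|$.
   Context: A natural unit interval order is a poset $P$ on $[n]$ such that (1) $x<_P y$ implies $x<y$ as integers, and (2) whenever the disjoint union of a chain $x<_P z$ and an element $y$ (incomparable to both) is an induced subposet of $P$, then $x<y<z$ as integers. The incomparability graph $\mathrm{inc}(P)$ has vertex set $[n]$ and edges $\{a,b\}$ with $a,b$ incomparable in $P$; $E(\cdot)$ denotes edge set. For a graph $G$ on $[n]$ and $\sigma\in\mathfrak S_n$, $\mathrm{inv}_G(\sigma)=|\{(i,j):i<j,\ \sigma(i)>\sigma(j),\ \{\sigma(i),\sigma(j)\}\in E(G)\}|$. For a poset $P$ on $[n]$, $\mathrm{Des}_P(\sigma)=\{i\in[n-1]:\sigma(i)>_P\sigma(i+1)\}$ and $\mathrm{maj}_P(\sigma)=\sum_{i\in\mathrm{Des}_P(\sigma)}i$. Then $a_{P,j}(q)=\sum_{\sigma\in\mathfrak S_n,\ \mathrm{inv}_{\mathrm{inc}(P)}(\sigma)=j}q^{\mathrm{maj}_P(\sigma)}$. *)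

(* Defs.v *)
From mathcomp Require Import all_boot all_order all_algebra all_fingroup.

Set Implicit Arguments.
Unset Strict Implicit.
Unset Printing Implicit Defensive.

Import GRing.Theory.
Local Open Scope ring_scope.

(* [n] is represented by 'I_n, so integers and positions are shifted down by
   one; a poset on [n] is given by its strict order relation lt_P. *)

Definition strict_poset (n : nat) (lt_P : rel 'I_n) : Prop :=
  irreflexive lt_P /\ transitive lt_P.

Definition incomparable (n : nat) (lt_P : rel 'I_n) (a b : 'I_n) : bool :=
  [&& a != b, ~~ lt_P a b & ~~ lt_P b a].

Definition natural_unit_interval_order (n : nat) (lt_P : rel 'I_n) : Prop :=
  [/\ strict_poset lt_P,
      (forall x y : 'I_n, lt_P x y -> (x < y)%N)
    & (forall x y z : 'I_n, lt_P x z ->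
         incomparable lt_P x y -> incomparable lt_P y z ->
         (x < y < z)%N)].

(* A simple graph on [n] is given by its set of edges {a, b}. *)
Definition inc_edges (n : nat) (lt_P : rel 'I_n) : {set {set 'I_n}} :=
  [set [set p.1; p.2] | p : 'I_n * 'I_n & incomparable lt_P p.1 p.2].

Definition inv_graph (n : nat) (E : {set {set 'I_n}}) (s : 'S_n) : nat :=
  #|[set p : 'I_n * 'I_n |
      [&& (p.1 < p.2)%N, (s p.2 < s p.1)%N & [set s p.1; s p.2] \in E]]|.

Definition Des (n : nat) (lt_P : rel 'I_n) (s : 'S_n) : {set 'I_n} :=
  [set i : 'I_n |
    [exists k : 'I_n, (k == i.+1 :> nat) && lt_P (s k) (s i)]].

(* i : 'I_n stands for the position i.+1 of [n]. *)
Definition maj (n : nat) (lt_P : rel 'I_n) (s : 'S_n) : nat :=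
  (\sum_(i in Des lt_P s) i.+1)%N.

Definition a_poly (n : nat) (lt_P : rel 'I_n) (j : nat) : {poly int} :=
  \sum_(s : 'S_n | inv_graph (inc_edges lt_P) s == j) 'X^(maj lt_P s).

(* Main.v *)
Require Import Defs.
From mathcomp Require Import all_boot all_order all_algebra all_fingroup.
From mathcomp Require Import zify.

(** Cutting a permutation [s] at the positions outside a set [T] of P-descents
    yields an ordered partition of [n] into P-chains, that is, a proper colouring
    of the incomparability graph whose content depends only on [T], and
    [inv_graph] becomes the number of edges whose larger end has the smaller
    colour. Hence the permutations with [T \subset Des s] and [inv = j] are
    counted by a coefficient of the chromatic quasisymmetric function. Reversing
    the colours replaces [j] by [|E| - j] and reverses the content. For a natural
    unit interval order the vertices of two adjacent colours induce a disjoint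
    union of monotone paths; exchanging the two colours on the paths with an odd
    number of vertices preserves [j] and transposes the content, so the count is
    symmetric in the content. The counts for all [T] determine [a_poly], because
    [X^maj] is the sum over [T \subset Des s] of [prod_(i in T) (X^(i+1) - 1)]. *)

Set Implicit Arguments.
Unset Strict Implicit.
Unset Printing Implicit Defensive.

Import GRing.Theory Num.Theory.

Local Notation root := fingraph.root.

(** * Proper colourings of the incomparability graph and colour reversal *)

Section Colorings.

Variables (n m : nat) (lt_P : rel 'I_n).
Implicit Types (k : {ffun 'I_n -> 'I_m}) (x y z : 'I_n) (c d u : 'I_m)
  (al : {ffun 'I_m -> nat}).

Local Notation inc := (incomparable lt_P).

Definition proper_coloring k :=
  [forall x, forall y, inc x y ==> (k x != k y)].

Definition color_descents k : nat :=
  #|[set p : 'I_n * 'I_n | [&& p.1 < p.2, inc p.1 p.2 & k p.2 < k p.1]]|.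

Definition content k : {ffun 'I_m -> nat} := [ffun u => #|[set x | k x == u]|].

Definition colorings_of (j : nat) (al : {ffun 'I_m -> nat}) :=
  [set k | [&& proper_coloring k, color_descents k == j & content k == al]].

Lemma proper_coloringP k :
  reflect (forall x y, inc x y -> k x != k y) (proper_coloring k).
Proof.
apply: (iffP forallP) => [h x y|h x]; last by apply/forallP => y; apply/implyP/h.
by move/forallP: (h x) => /(_ y)/implyP.
Qed.

Lemma incomparable_sym x y : inc x y = inc y x.
Proof. by rewrite /incomparable eq_sym; congr andb; rewrite andbC. Qed.

Lemma incomparable_edge x y : ([set x; y] \in inc_edges lt_P) = inc x y.
Proof.
apply/imsetP/idP => [[[a b]]|h]; last by exists (x, y); rewrite ?inE.
rewrite inE /= => hab e.
have: a \in [set x; y] by rewrite e !inE eqxx.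
have: b \in [set x; y] by rewrite e !inE eqxx orbT.
have nab : a != b by case/and3P: hab.
rewrite !inE => /orP[]/eqP eb /orP[]/eqP ea; subst a b => //;
  by [rewrite eqxx in nab | rewrite incomparable_sym].
Qed.

Lemma card_inc_edges :
  #|inc_edges lt_P| = #|[set p : 'I_n * 'I_n | (p.1 < p.2) && inc p.1 p.2]|.
Proof.
rewrite -[RHS](card_in_imset (f := fun p : 'I_n * 'I_n => [set p.1; p.2])).
  apply: eq_card => A; apply/imsetP/imsetP => -[[a b]]; rewrite inE /=.
    move=> hab ->; have nab : a != b by case/and3P: hab.
    case: (ltngtP a b) => h.
    - by exists (a, b); rewrite // inE /= h hab.
    - by exists (b, a); [rewrite inE /= h incomparable_sym | rewrite setUC].
    - by rewrite (val_inj h) eqxx in nab.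
  by case/andP=> h1 h2 ->; exists (a, b); rewrite ?inE.
move=> [a b] [a' b']; rewrite !inE /= => /andP[h _] /andP[h' _] e.
have: a \in [set a'; b'] by rewrite -e !inE eqxx.
have: b \in [set a'; b'] by rewrite -e !inE eqxx orbT.
have: a' \in [set a; b] by rewrite e !inE eqxx.
rewrite !inE => /orP[]/eqP ? /orP[]/eqP ? /orP[]/eqP ?; subst => //; lia.
Qed.

(** Properness excludes equal colours at the ends of an edge, so after reversal exactly the edges
    not counted before are counted. *)
Lemma color_descents_rev k : proper_coloring k ->
  color_descents [ffun x => rev_ord (k x)] = #|inc_edges lt_P| - color_descents k.
Proof.
move/proper_coloringP => pk; rewrite card_inc_edges /color_descents.
set A := [set p | _]; set B := [set p | _ && _]; set C := [set p | _].
have sCB : C \subset B.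
  by apply/subsetP => -[a b]; rewrite !inE /= => /and3P[-> ->].
rewrite -(setIidPr sCB) -cardsD; apply: eq_card => -[a b].
rewrite !inE /= !ffunE /=.
case: (boolP (inc a b)) => [h|_]; rewrite ?andbF //=.
have := pk _ _ h; rewrite -val_eqE /= => ne.
have := ltn_ord (k a); have := ltn_ord (k b); lia.
Qed.

Lemma color_descents_le k : color_descents k <= #|inc_edges lt_P|.
Proof.
rewrite card_inc_edges; apply: subset_leq_card.
by apply/subsetP => -[a b]; rewrite !inE /= => /and3P[-> ->].
Qed.

Lemma card_colorings_rev j al : j <= #|inc_edges lt_P| ->
  #|colorings_of (#|inc_edges lt_P| - j) [ffun u => al (rev_ord u)]|
    = #|colorings_of j al|.
Proof.
move=> lej.
pose f k := [ffun x => rev_ord (k x)].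
have fK : involutive f by move=> k; apply/ffunP => x; rewrite !ffunE rev_ordK.
have fP k : proper_coloring (f k) = proper_coloring k.
  apply/proper_coloringP/proper_coloringP => h x y /h;
  by rewrite !ffunE (inj_eq rev_ord_inj).
rewrite -(card_imset _ (inv_inj fK)); apply: eq_card => k.
rewrite -[k in LHS]fK (mem_imset _ _ (inv_inj fK)) !inE fP.
case: (boolP (proper_coloring k)) => //= pk.
rewrite color_descents_rev //; have := color_descents_le k.
move=> leD; congr andb.
  (* Subtraction is truncated: both bounds are needed to get [D = j] back from [E - D = E - j]. *)
  move: (color_descents k) #|inc_edges lt_P| lej leD => D E; lia.
apply/eqP/eqP => e.
  apply/ffunP => u; move/ffunP/(_ (rev_ord u)): e; rewrite !ffunE rev_ordK => <-.
  by apply: eq_card => x; rewrite !inE ffunE (inj_eq rev_ord_inj).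
apply/ffunP => u; rewrite -e !ffunE.
by apply: eq_card => x; rewrite !inE ffunE (can2_eq rev_ordK rev_ordK).
Qed.

End Colorings.

(** * Signed edge counts in graphs whose components are monotone paths *)

Lemma root_edge (T : finType) (e : rel T) x y :
  symmetric e -> e x y -> root e x = root e y.
Proof.
by move=> /sym_connect_sym e_csym /connect1; apply: (fingraph.rootP e_csym).
Qed.

Section SmallerNeighbors.

Variables (T : finType) (e lt : rel T) (g : T -> bool).
Hypothesis e_sym : symmetric e.
Hypothesis lt_irr : irreflexive lt.
Hypothesis lt_tr : transitive lt.
Hypothesis lt_total : forall x y, x != y -> lt x y || lt y x.
Hypothesis no_between :
  forall x y z, e x y -> lt x z -> lt z y -> ~~ connect e x z.

Let e_csym : connect_sym e := sym_connect_sym e_sym.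

(** Otherwise the vertices below [y] in its component would be closed under [e]: an edge leaving
    them ends at [y] or jumps over it, and [no_between] forbids the jump. But this set contains [m]
    and not [y]. *)
Lemma exists_smaller_neighbor m y :
  connect e m y -> lt m y -> exists a, e a y && lt a y.
Proof.
move=> cmy lmy; apply/existsP; apply: contraT => /existsPn noa.
have step u v : connect e m u -> e u v -> lt u y -> lt v y.
  move=> cmu euv luy; have [eq_vy|ne_vy] := eqVneq v y.
    by have := noa u; rewrite -{1}eq_vy euv luy.
  case/orP: (lt_total ne_vy) => // lyv.
  have := no_between euv luy lyv.
  by rewrite (connect_trans _ cmy) // e_csym.
pose A := [pred z | connect e m z && lt z y].
have clA : closed e A.
  move=> u v euv; rewrite !inE.
  have cuv := connect1 euv.
  have eq_c : connect e m u = connect e m v.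
    apply/idP/idP => h; first exact: connect_trans h cuv.
    by apply: connect_trans h _; rewrite e_csym.
  rewrite -eq_c; case: (boolP (connect e m u)) => //= cu.
  apply/idP/idP; first exact: step.
  by apply: step; rewrite -?eq_c // e_sym.
by have := closed_connect clA cmy; rewrite !inE connect0 lmy lt_irr andbF.
Qed.

(** Of two such neighbours, the larger would lie strictly between the ends of an edge and be
    connected to them through [y]. *)
Lemma smaller_neighbor_uniq a b y :
  e a y -> lt a y -> e b y -> lt b y -> a = b.
Proof.
wlog lab : a b / lt a b => [hw|] eay lay eby lby.
  have [//|/lt_total/orP[]h] := eqVneq a b; first exact: hw.
  by apply/esym/hw.
have := no_between eay lab lby.
by rewrite (connect_trans (connect1 eay)) // connect1 // e_sym.
Qed.

Local Open Scope ring_scope.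

(** If [g] marks the smaller of two adjacent colours, this is the change in the number of colour
    descents when the colours are exchanged on an edge with larger end [x]. *)
Definition color_sign x : int := if g x then -1 else 1.

(** Every vertex of the component has exactly one smaller neighbour, except the minimum [m], which
    has none. *)
Lemma sum_smaller_neighbors r : root e r == r ->
  exists2 m, root e m == r &
  \sum_(y | root e y == r) \sum_(a | e a y && lt a y) color_sign y =
    \sum_(y | root e y == r) color_sign y - color_sign m.
Proof.
(* The minimum for [lt] is found as the vertex with the fewest elements below it. *)
move=> rr; have [m rm min_m] := @arg_minnP _ r (fun x => root e x == r)
                                   (fun x => #|[set z | lt z x]|) rr.
exists m => //; rewrite (bigD1 m) //=.
rewrite [X in _ = X - _](bigD1 m) //= addrC [X in _ = X]addrC addKr.
have lt_m y : root e y == r -> y != m -> lt m y.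
  move=> ry ne; case/orP: (lt_total ne) => // lym.
  have := min_m _ ry; rewrite leqNgt => /negP[]; apply: proper_card.
  apply/properP; split; last by exists y; rewrite inE ?lt_irr.
  by apply/subsetP => z; rewrite !inE => /lt_tr; apply.
have con y z : root e y == r -> root e z == r -> connect e y z.
  by move=> /eqP ry /eqP rz; apply/(fingraph.rootP e_csym); rewrite ry rz.
have -> : \sum_(a | e a m && lt a m) color_sign m = 0.
  apply: big_pred0 => a; apply/negP => /andP[eam lam].
  have ra : root e a == r.
    by rewrite (root_edge e_sym eam).
  have ne : a != m by apply: contraTneq lam => ->; rewrite lt_irr.
  by have := lt_tr lam (lt_m _ ra ne); rewrite lt_irr.
rewrite addr0; apply: eq_bigr => y /andP[ry ne].
have [a ha] := exists_smaller_neighbor (con _ _ rm ry) (lt_m _ ry ne).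
rewrite (big_pred1 a) // => b; apply/idP/eqP => [/andP[eb lb]|-> //].
by case/andP: ha => ea la; apply: smaller_neighbor_uniq eb lb ea la.
Qed.

End SmallerNeighbors.

Section ComponentBalance.

Variables (T : finType) (e lt : rel T) (g : T -> bool).
Hypothesis e_sym : symmetric e.
Hypothesis lt_irr : irreflexive lt.
Hypothesis lt_tr : transitive lt.
Hypothesis lt_total : forall x y, x != y -> lt x y || lt y x.
Hypothesis no_between :
  forall x y z, e x y -> lt x z -> lt z y -> ~~ connect e x z.
Hypothesis g_proper : forall x y, e x y -> g x != g y.

Local Open Scope ring_scope.

Local Notation sg := (color_sign g).
Local Notation edge_sum r :=
  (\sum_(y | root e y == r) \sum_(a | e a y && lt a y) sg y).
Local Notation sign_sum r := (\sum_(y | root e y == r) sg y).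

(* A component is a path that is increasing for [lt] and alternates in sign.
   Counting each edge once at its upper and once at its lower end gives
   [2 * sign_sum = sg min + sg max]; parity then settles both claims. *)
Lemma component_balance r : root e r == r ->
  (odd #|[set y | root e y == r]| -> edge_sum r = 0) /\
  (~~ odd #|[set y | root e y == r]| -> sign_sum r = 0).
Proof.
move=> rr; have e_csym := sym_connect_sym e_sym.
have [m _ Em] := sum_smaller_neighbors g e_sym lt_irr lt_tr lt_total
                   no_between rr.
have [M _ EM] : exists2 M, root e M == r &
    \sum_(y | root e y == r) \sum_(a | e a y && lt y a) sg y = sign_sum r - sg M.
  apply: (@sum_smaller_neighbors T e (fun x y => lt y x)) => //.
  - by move=> y x z h1 h2; apply: lt_tr h2 h1.
  - by move=> x y /lt_total; rewrite orbC.
  - move=> x y z exy lzx lyz; have := no_between _ lyz lzx.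
    rewrite e_sym => /(_ exy); apply: contra => cxz.
    by rewrite (connect_trans _ cxz) // connect1 // e_sym.
(* Regrouping the edges by their larger end replaces the sign of one end by that of the other, which
   is opposite. *)
have EN : \sum_(y | root e y == r) \sum_(a | e a y && lt y a) sg y = - edge_sum r.
  rewrite (exchange_big_dep (fun a => root e a == r)) /=; last first.
    move=> x y /eqP rx /andP[eyx _]; rewrite -rx.
    by rewrite (root_edge e_sym eyx).
  rewrite -sumrN; apply: eq_bigr => y ry; rewrite -sumrN.
  apply: eq_big => x.
    rewrite e_sym; case: (boolP (e x y)) => [exy|]; rewrite ?andbF //=.
    by rewrite (root_edge e_sym exy) ry.
  case/and3P=> _ eyx _; have := g_proper eyx; rewrite /color_sign.
  by case: (g x); case: (g y).
(* Hence [sign_sum] has the parity of the component's size: it is [0] if even, and the common sign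
   of [m] and [M] if odd. *)
have ES : sign_sum r = #|[set y | root e y == r]|%:Z
                       - (#|[set y | (root e y == r) && g y]|)%:Z *+ 2.
  rewrite -!sum1dep_card !(big_morph Posz PoszD (erefl (0 : int))).
  rewrite big_mkcondr /= -sumrMnl -sumrB; apply: eq_bigr => y _.
  by rewrite /color_sign; case: (g y).
move: Em EM EN ES; move: (edge_sum r) (\sum_(_ | _) \sum_(_ | _) _) (sign_sum r).
by rewrite /color_sign; case: (g m); case: (g M); lia.
Qed.

End ComponentBalance.

(** * Bender-Knuth involution for two adjacent colours *)

Lemma incomparable_between (n : nat) (lt_P : rel 'I_n) (x y z : 'I_n) :
  natural_unit_interval_order lt_P -> x < y -> y < z ->
  incomparable lt_P x z -> incomparable lt_P x y /\ incomparable lt_P y z.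
Proof.
case=> -[_ tr] nat_P unit_P lxy lyz ixz.
have Nlt (a b : 'I_n) : (a < b)%N -> ~~ lt_P b a.
  by move=> lab; apply/negP => /nat_P; lia.
have ne (a b : 'I_n) : (a < b)%N -> a != b by rewrite -val_eqE /=; lia.
have [_ Nxz _] := and3P ixz.
(* Were [x] below [y] in P, transitivity would make [z] incomparable to both, and the unit interval
   condition would place [z] between them. *)
have Nxy : ~~ lt_P x y.
  apply/negP => hxy.
  have Nyz : ~~ lt_P y z by apply/negP => hyz; rewrite (tr _ _ _ hxy hyz) in Nxz.
  have izy : incomparable lt_P z y.
    by rewrite incomparable_sym /incomparable ne ?Nyz ?Nlt.
  by have := unit_P _ _ _ hxy ixz izy; lia.
have ixy : incomparable lt_P x y by rewrite /incomparable ne ?Nxy ?Nlt.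
split=> //; rewrite /incomparable (ne _ _ lyz) (Nlt _ _ lyz) andbT /=.
apply/negP => hyz.
have := unit_P _ x _ hyz; rewrite incomparable_sym => /(_ ixy ixz); lia.
Qed.

Section BenderKnuth.

Variables (n m : nat) (lt_P : rel 'I_n) (c d : 'I_m).
Hypothesis P_nat : natural_unit_interval_order lt_P.
Hypothesis cd : d = c.+1 :> nat.
Implicit Types (k : {ffun 'I_n -> 'I_m}) (x y z : 'I_n) (u : 'I_m).

Local Notation inc := (incomparable lt_P).

Definition two_colored k x := (k x == c) || (k x == d).

Definition two_color_edge k x y := [&& two_colored k x, two_colored k y & inc x y].

(** A vertex with neither colour is a component by itself, hence odd; the transposition in
    [bender_knuth] then fixes its colour. *)
Definition odd_component k x :=
  odd #|[set y | root (two_color_edge k) y == root (two_color_edge k) x]|.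

Definition bender_knuth k : {ffun 'I_n -> 'I_m} :=
  [ffun x => if odd_component k x then tperm c d (k x) else k x].

Lemma two_color_edge_sym k : symmetric (two_color_edge k).
Proof. by move=> x y; rewrite /two_color_edge andbCA incomparable_sym. Qed.

Lemma neq_cd : c != d.
Proof. by rewrite -val_eqE /= cd; lia. Qed.

Lemma two_colored_bender_knuth k x :
  two_colored (bender_knuth k) x = two_colored k x.
Proof.
rewrite /two_colored ffunE; case: ifP => // _.
by rewrite ![tperm _ _ _ == _](can2_eq (tpermK _ _) (tpermK _ _)) tpermL tpermR orbC.
Qed.

Lemma odd_component_bender_knuth k x :
  odd_component (bender_knuth k) x = odd_component k x.
Proof.
rewrite /odd_component; congr (odd _); apply: eq_card => y; rewrite !inE.
have E : two_color_edge (bender_knuth k) =2 two_color_edge k.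
  by move=> a b; rewrite /two_color_edge !two_colored_bender_knuth.
by rewrite !(eq_root E).
Qed.

Lemma bender_knuthK : involutive bender_knuth.
Proof.
move=> k; apply/ffunP => x; rewrite ffunE odd_component_bender_knuth ffunE.
by case: (odd_component k x); rewrite ?tpermK.
Qed.

Lemma bender_knuth_id k x : ~~ two_colored k x -> bender_knuth k x = k x.
Proof.
rewrite ffunE negb_or => /andP[nc nd]; case: ifP => // _.
by rewrite tpermD // eq_sym.
Qed.

Lemma odd_component_edge k x y :
  two_color_edge k x y -> odd_component k x = odd_component k y.
Proof. by move=> exy; rewrite /odd_component (root_edge (@two_color_edge_sym k) exy). Qed.

Lemma connect_two_colored k x y :
  connect (two_color_edge k) x y -> x != y -> two_colored k x.
Proof.
case/connectP => -[|z p] /=; first by move=> _ ->; rewrite eqxx.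
by case/andP => /and3P[].
Qed.

Lemma even_component_two_colored k x : ~~ odd_component k x -> two_colored k x.
Proof.
apply: contraR => nx; rewrite /odd_component.
suff -> : [set y | root (two_color_edge k) y == root (two_color_edge k) x] = [set x].
  by rewrite cards1.
apply/setP => y; rewrite !inE; apply/eqP/eqP => [e|-> //].
have csym := sym_connect_sym (@two_color_edge_sym k).
have : connect (two_color_edge k) x y by apply/(fingraph.rootP csym).
move/connect_two_colored; case: eqVneq => // _ /(_ isT) h.
by rewrite h in nx.
Qed.

(** An edge within the two colours lies in one component, so both ends are exchanged or neither; any
    other edge has at most one end with these colours, and this is preserved. *)
Lemma proper_bender_knuth k :
  proper_coloring lt_P k -> proper_coloring lt_P (bender_knuth k).
Proof.
move=> /proper_coloringP pk; apply/proper_coloringP => x y ixy.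
have [hx|hx] := boolP (two_colored k x); have [hy|hy] := boolP (two_colored k y).
- rewrite !ffunE (@odd_component_edge k x y) /two_color_edge ?hx ?hy //.
  by case: ifP => _; rewrite ?(inj_eq perm_inj) pk.
- apply: contraNneq hy => e; rewrite -two_colored_bender_knuth /two_colored -e.
  by rewrite -/(two_colored (bender_knuth k) x) two_colored_bender_knuth.
- apply: contraNneq hx => e; rewrite -two_colored_bender_knuth /two_colored e.
  by rewrite -/(two_colored (bender_knuth k) y) two_colored_bender_knuth.
- by rewrite !bender_knuth_id // pk.
Qed.

Section Balance.

Variables (k : {ffun 'I_n -> 'I_m}).
Hypothesis pk : proper_coloring lt_P k.

Local Notation e := (two_color_edge k).
Local Notation g := (fun x => k x == c).

Lemma two_color_edge_alternates x y : e x y -> g x != g y.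
Proof.
move/proper_coloringP: pk => pk' /and3P[/orP[]/eqP hx /orP[]/eqP hy /pk'];
  by rewrite hx hy ?eqxx // ?[d == c]eq_sym (negPf neq_cd).
Qed.

(** If [z] were in the component, it would have one of the two colours, and [incomparable_between]
    would give a properly 2-coloured triangle. *)
Lemma two_color_edge_no_between x y z :
  e x y -> x < z -> z < y -> ~~ connect e x z.
Proof.
move=> exy lxz lzy; apply/negP => cxz.
have hz : two_colored k z.
  rewrite (sym_connect_sym (@two_color_edge_sym k)) in cxz.
  by apply: connect_two_colored cxz _; rewrite -val_eqE /=; lia.
have [hx hy ixy] := and3P exy.
have [ixz izy] := incomparable_between P_nat lxz lzy ixy.
have exz : e x z by rewrite /two_color_edge hx hz.
have ezy : e z y by rewrite /two_color_edge hy hz.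
move: (two_color_edge_alternates exz) (two_color_edge_alternates ezy)
  (two_color_edge_alternates exy).
by case: (k x == c); case: (k y == c); case: (k z == c).
Qed.

Local Open Scope ring_scope.

Lemma two_color_balance r : root e r == r ->
  (odd #|[set y | root e y == r]| ->
    \sum_(y | root e y == r) \sum_(a | e a y && (a < y)%N) color_sign g y = 0) /\
  (~~ odd #|[set y | root e y == r]| ->
    \sum_(y | root e y == r) color_sign g y = 0).
Proof.
apply: (component_balance (lt := fun x y : 'I_n => (x < y)%N)).
- exact: two_color_edge_sym.
- by move=> x; rewrite ltnn.
- by move=> y x z; apply: ltn_trans.
- by move=> x y; rewrite -val_eqE neq_ltn.
- exact: two_color_edge_no_between.
- exact: two_color_edge_alternates.
Qed.

Lemma sum_by_component (F : 'I_n -> int) (Q : pred 'I_n) :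
  (forall x y, root e x = root e y -> Q x = Q y) ->
  (forall r, root e r == r -> Q r -> \sum_(y | root e y == r) F y = 0) ->
  \sum_(y | Q y) F y = 0.
Proof.
move=> Qroot Fcomp; have csym := sym_connect_sym (@two_color_edge_sym k).
rewrite (partition_big (root e) (fun r => (root e r == r) && Q r)) /=; last first.
  move=> x Qx; rewrite (root_root csym) eqxx /=.
  by rewrite (Qroot _ x) ?(root_root csym).
apply: big1 => r /andP[rr Qr].
rewrite -[RHS](Fcomp r) //; apply: eq_bigl => y.
case: eqP => [ry|]; rewrite ?andbF // andbT.
by rewrite (Qroot _ r) // (eqP rr).
Qed.

(** Only edges inside odd components can change status, and by [two_color_balance] their changes
    cancel in each such component. *)
Lemma color_descents_bender_knuth :
  color_descents lt_P (bender_knuth k) = color_descents lt_P k.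
Proof.
have Dint k' : (color_descents lt_P k')%:Z =
    \sum_(y : 'I_n) \sum_(a : 'I_n | (a < y)%N && inc a y) (k' y < k' a)%N%:Z.
  rewrite /color_descents -sum1dep_card (big_morph Posz PoszD (erefl (0 : int))).
  rewrite (exchange_big_dep predT) //= pair_big_dep /= [RHS]big_mkcond /= big_mkcond /=.
  by apply: eq_bigr => -[a y] _ /=; case: (_ < _)%N; case: inc; case: (_ < _)%N.
apply/eqP; rewrite -eqz_nat !Dint -subr_eq0 -sumrB; apply/eqP.
transitivity (\sum_(y | odd_component k y)
                \sum_(a | e a y && (a < y)%N) color_sign g y); last first.
  apply: sum_by_component => [x y|r rr]; first by rewrite /odd_component => ->.
  by rewrite /odd_component (eqP rr); apply (two_color_balance rr).
rewrite [RHS]big_mkcond; apply: eq_bigr => y _; rewrite -sumrB.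
rewrite [LHS]big_mkcond.
transitivity (\sum_a if [&& odd_component k y, e a y & (a < y)%N]
              then color_sign g y else 0); last first.
  by case: (odd_component k y); rewrite -?big_mkcond //= big1.
apply: eq_bigr => a _; case lay : (a < y)%N; rewrite ?andbF //=.
case iay : (inc a y); last by rewrite /two_color_edge iay !andbF.
rewrite /two_color_edge iay !andbT.
have [ha|ha] := boolP (two_colored k a); have [hy|hy] := boolP (two_colored k y).
- have eay : e a y by rewrite /two_color_edge ha hy.
  rewrite !ffunE (odd_component_edge eay) /= andbT.
  case: (odd_component k y); last by rewrite subrr.
  have := two_color_edge_alternates eay; rewrite /color_sign.
  case/orP: ha => /eqP ->; case/orP: hy => /eqP ->;
    rewrite ?eqxx // ?[d == c]eq_sym ?(negPf neq_cd) // tpermL tpermR cd;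
    by rewrite ltnSn ltnNge leqnSn.
(* [c] and [d] are consecutive, so a third colour compares in the same way with both. *)
- rewrite (bender_knuth_id hy) andbF.
  suff -> : (k y < bender_knuth k a)%N = (k y < k a)%N by rewrite subrr /= ?andbF.
  have : two_colored (bender_knuth k) a by rewrite two_colored_bender_knuth.
  move: ha hy; rewrite /two_colored -!val_eqE /= cd.
  move: (bender_knuth k a) (k a) (k y) => u v w; lia.
- rewrite (bender_knuth_id ha) andbF.
  suff -> : (bender_knuth k y < k a)%N = (k y < k a)%N by rewrite subrr /= ?andbF.
  have : two_colored (bender_knuth k) y by rewrite two_colored_bender_knuth.
  move: ha hy; rewrite /two_colored -!val_eqE /= cd.
  move: (bender_knuth k y) (k a) (k y) => u v w; lia.
- by rewrite !bender_knuth_id // subrr /= ?andbF.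
Qed.

(** Odd components exchange their colours, while even ones contain both colours equally often. *)
Lemma content_bender_knuth u :
  content (bender_knuth k) u = content k (tperm c d u).
Proof.
rewrite !ffunE -!sum1dep_card; apply/eqP; rewrite -eqz_nat.
rewrite !(big_morph Posz PoszD (erefl (0 : int))) -subr_eq0.
rewrite big_mkcond [X in _ - X]big_mkcond -sumrB.
(* For [x] in an even component, [F x] is the indicator of [k x = u] minus that of
   [k x = tperm c d u]. *)
pose F x : int := if u == d then color_sign g x
                  else if u == c then - color_sign g x else 0.
rewrite (eq_bigr (fun x => if ~~ odd_component k x then F x else 0)) => [|x _].
  rewrite -big_mkcond; apply/eqP; apply: sum_by_component => [x y|r rr].
    by rewrite /odd_component => ->.
  rewrite /odd_component (eqP rr) => h; have [_ /(_ h) E] := two_color_balance rr.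
  rewrite /F; case: (u == d) => //; case: (u == c); last by rewrite big1.
  by rewrite sumrN E oppr0.
rewrite ffunE; case: (boolP (odd_component k x)) => ox /=.
  by rewrite (can2_eq (tpermK _ _) (tpermK _ _)) subrr.
have := even_component_two_colored ox.
rewrite /F /color_sign; case: (tpermP c d u) => [->|->|/eqP nc /eqP nd].
- by case/orP=> /eqP->; rewrite ?eqxx ?[d == c]eq_sym ?(negPf neq_cd).
- by case/orP=> /eqP->; rewrite ?eqxx ?[d == c]eq_sym ?(negPf neq_cd).
- by rewrite (negPf nc) (negPf nd) subrr.
Qed.

End Balance.

Lemma card_colorings_adjacent j (al : {ffun 'I_m -> nat}) :
  #|colorings_of lt_P j [ffun u => al (tperm c d u)]| = #|colorings_of lt_P j al|.
Proof.
rewrite -(card_imset _ (inv_inj bender_knuthK)); apply: eq_card => k.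
rewrite -[k in LHS]bender_knuthK (mem_imset _ _ (inv_inj bender_knuthK)) !inE.
have -> : proper_coloring lt_P (bender_knuth k) = proper_coloring lt_P k.
  apply/idP/idP; last exact: proper_bender_knuth.
  by move/proper_bender_knuth; rewrite bender_knuthK.
case: (boolP (proper_coloring lt_P k)) => //= pk.
rewrite color_descents_bender_knuth //; congr andb.
apply/eqP/eqP => e; apply/ffunP => u.
  move/ffunP/(_ (tperm c d u)): e; rewrite content_bender_knuth // tpermK => ->.
  by rewrite ffunE tpermK.
by rewrite content_bender_knuth // e ffunE.
Qed.

End BenderKnuth.

(** * Symmetry of the colouring counts in the content *)

Section PermutedContent.

Variables (n m : nat) (lt_P : rel 'I_n) (j : nat).
Hypothesis P_nat : natural_unit_interval_order lt_P.

Let symm (s : 'S_m) := forall al : {ffun 'I_m -> nat},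
  #|colorings_of lt_P j [ffun u => al (s u)]| = #|colorings_of lt_P j al|.

Lemma card_colorings_mul s t : symm s -> symm t -> symm (s * t)%g.
Proof.
move=> hs ht al; rewrite -[RHS]ht -[RHS]hs; congr #|pred_of_set (colorings_of _ _ _)|.
by apply/ffunP => u; rewrite !ffunE permM.
Qed.

(** Induction on [b - a]: with [b'] the predecessor of [b], conjugating [tperm a b'] by the adjacent
    transposition [tperm b' b] gives [tperm a b]. *)
Lemma card_colorings_tperm a b : symm (tperm a b).
Proof.
wlog lab : a b / a < b => [hw|].
  case: (ltngtP a b) => [|h|/val_inj ->]; first exact: hw.
    by rewrite tpermC; apply: hw.
  move=> al; congr #|pred_of_set (colorings_of _ _ _)|.
  by apply/ffunP => u; rewrite ffunE tperm1 perm1.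
move: {2}(b - a) (leqnn (b - a)) => l; elim: l b lab => [|l IH] b lab hl; first lia.
have [eb|ne] := eqVneq (b : nat) a.+1; first by move=> al; apply: card_colorings_adjacent.
have hb : b.-1 < m by have := ltn_ord b; lia.
pose b' := Ordinal hb.
have sb : symm (tperm b' b).
  by move=> al; apply: card_colorings_adjacent => //=; lia.
have sa : symm (tperm a b') by apply: IH => /=; lia.
have -> : tperm a b = (tperm b' b * tperm a b' * tperm b' b)%g.
  have := tpermJ a b' (tperm b' b); rewrite /conjg tpermV mulgA tpermL => ->.
  by rewrite tpermD // -val_eqE /=; lia.
by do 2 ?apply: card_colorings_mul.
Qed.

Lemma card_colorings_perm s : symm s.
Proof.
have [ts -> _] := prod_tpermP s; elim: ts => [|t ts IH].
  move=> al; rewrite big_nil; congr #|pred_of_set (colorings_of _ _ _)|.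
  by apply/ffunP => u; rewrite ffunE perm1.
by rewrite big_cons; apply: card_colorings_mul => //; apply: card_colorings_tperm.
Qed.

End PermutedContent.

(** Colour reversal also reverses the content; symmetry under the permutation [rev_ord] undoes
    this. *)
Lemma card_colorings_palindromic (n m : nat) (lt_P : rel 'I_n) j
    (al : {ffun 'I_m -> nat}) :
  natural_unit_interval_order lt_P -> j <= #|inc_edges lt_P| ->
  #|colorings_of lt_P j al| = #|colorings_of lt_P (#|inc_edges lt_P| - j) al|.
Proof.
move=> P_nat lej; rewrite -card_colorings_rev //.
rewrite -(card_colorings_perm _ P_nat (perm rev_ord_inj)).
by congr #|pred_of_set (colorings_of _ _ _)|; apply/ffunP => u; rewrite !ffunE permE rev_ordK.
Qed.

(** * Permutations with prescribed descents as colourings *)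

Section Blocks.

Variables (n : nat) (lt_P : rel 'I_n) (T : {set 'I_n}).
Hypothesis P_nat : natural_unit_interval_order lt_P.
Implicit Types (s : 'S_n) (p q : 'I_n).

Lemma block_subproof p : #|[set i : 'I_n | (i < p) && (i \notin T)]| < n.
Proof.
rewrite -[ltnRHS]card_ord -cardsT; apply: proper_card; apply/properP.
by split; [apply: subsetT | exists p; rewrite !inE ?ltnn].
Qed.

(** A cut follows each position outside [T], so the number of earlier cuts is the index of the block
    of [p]. *)
Definition block p : 'I_n := Ordinal (block_subproof p).

Lemma leq_block p q : p <= q -> block p <= block q.
Proof.
move=> lpq; apply: subset_leq_card; apply/subsetP => i; rewrite !inE.
by case/andP=> /leq_trans/(_ lpq)->.
Qed.

Lemma block_succ p q : q = p.+1 :> nat -> (block q == block p) = (p \in T).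
Proof.
move=> eq; rewrite -val_eqE /= eq_sym eqn_leq.
have -> /= : #|[set i : 'I_n | (i < p) && (i \notin T)]|
             <= #|[set i : 'I_n | (i < q) && (i \notin T)]|.
  by apply: leq_block; rewrite eq.
have [pT|pT] := boolP (p \in T).
  apply: subset_leq_card; apply/subsetP => i; rewrite !inE eq ltnS leq_eqVlt.
  by case/andP=> /orP[/eqP/val_inj->|->] //; rewrite pT.
apply/negbTE; rewrite -ltnNge; apply: proper_card; apply/properP; split.
  by apply/subsetP => i; rewrite !inE eq => /andP[/ltnW]; rewrite ltnS => ->.
by exists p; rewrite !inE ?ltnn ?eq ?ltnSn.
Qed.

(** All positions from [p] to just before [q] lie in [T], so they are P-descents and transitivity
    chains them. *)
Lemma block_decreasing s p q : T \subset Des lt_P s ->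
  p < q -> block p = block q -> lt_P (s q) (s p).
Proof.
case: P_nat => -[_ tr] _ _ /subsetP sT.
move: {2}(q - p) (leqnn (q - p)) => l; elim: l q => [|l IH] q hl lpq eqb; first lia.
have hq : q.-1 < n by have := ltn_ord q; lia.
pose q' := Ordinal hq.
have eq : q = q'.+1 :> nat by rewrite /=; lia.
have lpq' : p <= q' by rewrite /=; lia.
have lqq' : q' <= q by rewrite /=; lia.
have eqb' : block p = block q'.
  by apply/val_inj/eqP; rewrite eqn_leq [X in X && _]leq_block // eqb leq_block.
have : q' \in T by rewrite -(block_succ eq) -eqb eqb'.
move/sT; rewrite inE => /existsP[r /andP[/eqP er hr]].
have -> : q = r by apply/val_inj; rewrite /= er.
have [epq|ne] := eqVneq p q'; first by rewrite epq.
apply: tr hr (IH q' _ _ eqb'); last by rewrite ltn_neqAle val_eqE ne.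
by rewrite /=; lia.
Qed.

Definition block_coloring s : {ffun 'I_n -> 'I_n} := [ffun x => block (s^-1%g x)].

Definition block_content : {ffun 'I_n -> nat} := [ffun u => #|[set p | block p == u]|].

Lemma block_coloringE s p : block_coloring s (s p) = block p.
Proof. by rewrite ffunE permK. Qed.

Lemma content_block_coloring s : content (block_coloring s) = block_content.
Proof.
apply/ffunP => u; rewrite !ffunE -[RHS](card_imset _ (@perm_inj _ s)).
apply: eq_card => x; rewrite inE -[x](permKV s) block_coloringE.
by rewrite (mem_imset _ _ perm_inj) inE.
Qed.

Lemma proper_block_coloring s : T \subset Des lt_P s ->
  proper_coloring lt_P (block_coloring s).
Proof.
move=> sT; apply/proper_coloringP => x y.
rewrite -[x](permKV s) -[y](permKV s) !block_coloringE.
move: (s^-1%g x) (s^-1%g y) => p q /and3P[ne n1 n2].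
apply/eqP => eqb; case: (ltngtP p q) => h.
- by rewrite (block_decreasing sT h eqb) in n2.
- by rewrite (block_decreasing sT h (esym eqb)) in n1.
- by rewrite (val_inj h) eqxx in ne.
Qed.

(** The ends of an edge lie in different blocks, so the end with the smaller colour is the one that
    occurs earlier in [s]. *)
Lemma color_descents_block_coloring s : T \subset Des lt_P s ->
  color_descents lt_P (block_coloring s) = inv_graph (inc_edges lt_P) s.
Proof.
move=> sT; have /proper_coloringP pk := proper_block_coloring sT.
pose f (p : 'I_n * 'I_n) := (s p.2, s p.1).
have f_inj : injective f by move=> [p q] [p' q'] [/perm_inj-> /perm_inj->].
rewrite /color_descents /inv_graph -[RHS](card_imset _ f_inj).
apply: eq_card => -[a b]; rewrite -[a](permKV s) -[b](permKV s).
move: (s^-1%g a) (s^-1%g b) => q p.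
rewrite -[(s q, s p)]/(f (p, q)) (mem_imset _ _ f_inj) !inE /=.
rewrite incomparable_edge incomparable_sym !block_coloringE.
case: (boolP (incomparable lt_P (s p) (s q))) => [h|]; rewrite ?andbF //= andbT.
have := pk _ _ h; rewrite !block_coloringE -val_eqE => ne.
rewrite andbC; congr andb; rewrite !ltnNge; congr (~~ _).
apply/idP/idP; last exact: leq_block.
apply: contraTT; rewrite -!ltnNge => lpq; rewrite ltn_neqAle ne.
exact/leq_block/ltnW.
Qed.


(* A permutation whose blocks are [P]-chains listed downwards is recovered from
   its block colouring by sorting [n] along this order. *)
Definition reading_order (k : {ffun 'I_n -> 'I_n}) : rel 'I_n :=
  fun x y => (k x < k y) || (k x == k y) && (y <= x).

Lemma reading_order_trans k : transitive (reading_order k).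
Proof.
move=> y x z; rewrite /reading_order -!val_eqE /=.
by move: (k x) (k y) (k z) => u v w; lia.
Qed.

Lemma reading_order_total k : total (reading_order k).
Proof.
move=> x y; rewrite /reading_order -!val_eqE /=.
by move: (k x) (k y) => u v; lia.
Qed.

Lemma reading_order_antisym k : antisymmetric (reading_order k).
Proof.
move=> x y; rewrite /reading_order -!val_eqE /= => h.
by apply/val_inj => /=; move: (k x) (k y) h => u v; lia.
Qed.

Lemma block_coloring_reading s p q : T \subset Des lt_P s -> p <= q ->
  reading_order (block_coloring s) (s p) (s q).
Proof.
case: P_nat => _ nat_P _ sT; rewrite leq_eqVlt => /orP[/eqP/val_inj->|lpq].
  by rewrite /reading_order eqxx leqnn orbT.
rewrite /reading_order !block_coloringE.
have := leq_block (ltnW lpq); rewrite leq_eqVlt => /orP[|-> //].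
rewrite val_eqE => /eqP e; rewrite e eqxx.
by rewrite (ltnW (nat_P _ _ (block_decreasing sT lpq e))) orbT.
Qed.

Lemma sorted_enum_ord : sorted (fun p q => p <= q) (enum 'I_n).
Proof. by have := iota_sorted 0 n; rewrite -val_enum_ord sorted_map. Qed.

Lemma perm_map_enum s : perm_eq (map s (enum 'I_n)) (enum 'I_n).
Proof.
apply: uniq_perm; rewrite ?(map_inj_uniq (@perm_inj _ s)) ?enum_uniq //.
move=> x; rewrite mem_enum; apply/mapP; exists (s^-1%g x); rewrite ?mem_enum //.
by rewrite permKV.
Qed.

(** Both words list [[n]] in increasing reading order, and that order depends on the colouring
    alone. *)
Lemma block_coloring_inj :
  {in [set s | T \subset Des lt_P s] &, injective block_coloring}.
Proof.
move=> s t; rewrite !inE => sT tT e.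
have srt r : T \subset Des lt_P r ->
    sorted (reading_order (block_coloring r)) (map r (enum 'I_n)).
  move=> rT; apply: homo_sorted sorted_enum_ord => p q.
  exact: block_coloring_reading.
have /eq_in_map h : map s (enum 'I_n) = map t (enum 'I_n).
  apply: (sorted_eq (@reading_order_trans (block_coloring s))
            (@reading_order_antisym _)); first exact: srt.
    by rewrite e; apply: srt.
  rewrite (perm_trans (perm_map_enum s)) // perm_sym; exact: perm_map_enum.
by apply/permP => p; apply: h; rewrite mem_enum.
Qed.

Lemma block_coloring_surj k : (forall i, i \in T -> i.+1 < n) ->
  proper_coloring lt_P k -> content k = block_content ->
  exists2 s, T \subset Des lt_P s & block_coloring s = k.
Proof.
case: P_nat => _ nat_P _ hT /proper_coloringP pk ck.
pose t := sort_tuple (reading_order k) (ord_tuple n).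
have t_perm : perm_eq t (enum 'I_n) by rewrite /= perm_sort.
have t_inj : injective (tnth t).
  by apply/tuple_uniqP; rewrite (perm_uniq t_perm) enum_uniq.
have t_sorted : sorted (reading_order k) t := sort_sorted (@reading_order_total k) _.
pose s := perm t_inj.
have sE p : s p = nth p t p by rewrite permE (tnth_nth p).
(* Both lists are weakly increasing, and equality of the contents makes them permutations of each
   other. *)
have eq_map : map k t = map block (enum 'I_n).
  apply: (@sorted_eq _ (fun u v : 'I_n => u <= v)).
  - by move=> v u w; apply: leq_trans.
  - by move=> u v h; apply/val_inj/eqP; rewrite eqn_leq.
  - apply: homo_sorted t_sorted => x y; rewrite /reading_order -val_eqE /=.
    by move: (k x) (k y) => u v; lia.
  - by apply: homo_sorted sorted_enum_ord => p q; apply: leq_block.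
  - apply/allP => u _; rewrite /= (count_map k) (count_map block) (seq.permP t_perm).
    have cnt (f : 'I_n -> 'I_n) :
        count (preim f (pred1 u)) (enum 'I_n) = #|[set x | f x == u]|.
      rewrite cardE [in RHS]/enum_mem size_filter -enumT.
      by apply: eq_count => x; rewrite !inE.
    by move/ffunP/(_ u): ck; rewrite !ffunE (cnt k) (cnt block) => ->.
have ks p : k (s p) = block p.
  have sz : p < size t by rewrite size_tuple.
  rewrite sE -(nth_map p (k p)) // eq_map (nth_map p) ?size_enum_ord //.
  by rewrite nth_ord_enum.
exists s; last by apply/ffunP => x; rewrite ffunE -ks permKV.
apply/subsetP => i iT; pose q := Ordinal (hT i iT).
rewrite inE; apply/existsP; exists q; rewrite eqxx /=.
have ekq : k (s q) = k (s i).
  by rewrite !ks; apply/eqP; rewrite block_succ.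
have : reading_order k (s i) (s q).
  rewrite !permE !(tnth_nth i).
  by apply: (sorted_ltn_nth (@reading_order_trans k)) => //; rewrite inE size_tuple ?ltn_ord.
rewrite /reading_order ekq ltnn eqxx /= => le_qi.
have ne : s i != s q by rewrite (inj_eq perm_inj) -val_eqE /=; lia.
(* Equal colours force comparability, and naturality of P makes the smaller integer [s q] the lower
   element. *)
case: (boolP (incomparable lt_P (s i) (s q))) => [/pk|]; first by rewrite ekq eqxx.
rewrite /incomparable ne /= negb_and !negbK => /orP[/nat_P|//].
by rewrite ltnNge le_qi.
Qed.

Lemma card_Des_superset j : (forall i, i \in T -> i.+1 < n) ->
  #|[set s | (inv_graph (inc_edges lt_P) s == j) && (T \subset Des lt_P s)]|
    = #|colorings_of lt_P j block_content|.
Proof.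
move=> hT; rewrite -(card_in_imset (f := block_coloring)); last first.
  by move=> s t; rewrite !inE => /andP[_ sT] /andP[_ tT]; apply: block_coloring_inj; rewrite inE.
apply: eq_card => k; rewrite inE; apply/imsetP/and3P.
  case=> s; rewrite inE => /andP[/eqP <- sT] ->.
  by rewrite proper_block_coloring // color_descents_block_coloring //
             content_block_coloring !eqxx.
case=> pk /eqP dk /eqP ck; have [s sT es] := block_coloring_surj hT pk ck.
by exists s; rewrite ?es // inE sT andbT -color_descents_block_coloring // es dk.
Qed.

End Blocks.

(** * Expansion of [a_poly] over sets of descents *)

Lemma Des_not_last (n : nat) (lt_P : rel 'I_n) (s : 'S_n) i :
  i \in Des lt_P s -> i.+1 < n.
Proof. by rewrite inE => /existsP[q /andP[/eqP <- _]]. Qed.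

Lemma card_Des_superset_palindromic (n : nat) (lt_P : rel 'I_n) (T : {set 'I_n}) j :
  natural_unit_interval_order lt_P -> j <= #|inc_edges lt_P| ->
  #|[set s | (inv_graph (inc_edges lt_P) s == j) && (T \subset Des lt_P s)]| =
  #|[set s | (inv_graph (inc_edges lt_P) s == #|inc_edges lt_P| - j)
             && (T \subset Des lt_P s)]|.
Proof.
move=> P_nat lej.
have [/forall_inP hT|/forall_inPn[i iT hi]] := boolP [forall i in T, i.+1 < n].
  by rewrite !card_Des_superset //; apply: card_colorings_palindromic.
(* If [T] contains the last position, no permutation has all of [T] as descents. *)
have e j' : #|[set s | (inv_graph (inc_edges lt_P) s == j')
                       && (T \subset Des lt_P s)]| = 0.
  apply: eq_card0 => s; rewrite inE; apply/negP => /andP[_ /subsetP/(_ i iT)].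
  by move/Des_not_last; rewrite (negPf hi).
by rewrite !e.
Qed.

Local Open Scope ring_scope.

Lemma a_poly_superset (n : nat) (lt_P : rel 'I_n) j :
  a_poly lt_P j = \sum_(T : {set 'I_n})
    (\prod_(i in T) ('X^(i.+1) - 1)) *+
      #|[set s | (inv_graph (inc_edges lt_P) s == j) && (T \subset Des lt_P s)]|.
Proof.
transitivity (\sum_(s : 'S_n | inv_graph (inc_edges lt_P) s == j)
  \sum_(T : {set 'I_n} | T \subset Des lt_P s) \prod_(i in T) ('X^(i.+1) - 1 : {poly int})).
  apply: eq_bigr => s _; rewrite /maj expr_sum.
  (* The summand [0] at non-descents kills every [T] not contained in the descent set when the
     product is distributed. *)
  transitivity (\prod_i ((if i \in Des lt_P s then 'X^(i.+1) - 1 else 0)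
                          + 1 : {poly int})).
    rewrite big_mkcond; apply: eq_bigr => i _.
    by case: ifP; rewrite ?subrK ?add0r.
  rewrite bigA_distr [RHS]big_mkcond; apply: eq_bigr => T _.
  case: ifP => [/subsetP sT|/negbT/subsetPn[i iT iD]].
    by rewrite [RHS]big_mkcond; apply: eq_bigr => i _; case: ifP => // /sT->.
  by rewrite (bigD1 i) //= iT (negPf iD) mul0r.
rewrite (exchange_big_dep predT) //=; apply: eq_bigr => T _.
by rewrite sumr_const; congr (_ *+ _); apply: eq_card => s; rewrite !inE.
Qed.

Close Scope ring_scope.

Theorem theorem3p2 (n : nat) (lt_P : rel 'I_n) :
  natural_unit_interval_order lt_P ->
  forall j : nat, (j <= #|inc_edges lt_P|)%N ->
    a_poly lt_P j = a_poly lt_P (#|inc_edges lt_P| - j)%N.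
Proof.
move=> P_nat j lej; rewrite !a_poly_superset; apply: eq_bigr => T _.
by rewrite card_Des_superset_palindromic.
Qed.
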